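(* Let $\mathcal{O}=\{t_1,\dots,t_\mu\}$ be an order ideal in $\mathbb{T}^n$ with border $\partial\mathcal{O}=\{b_1,\dots,b_\nu\}$, and let $K[C]=K[c_{11},\dots,c_{\mu\nu}]$ be the polynomial ring containing the ideal $I(\mathbb{B}_{\mathcal{O}})$ which defines the $\mathcal{O}$-border basis scheme. Then the following conditions are equivalent. (a) The order ideal $\mathcal{O}$ has a MaxDeg border, i.e., we have $\deg(b_j)\ge\deg(t_i)$ for $i=1,\dots,\mu$ and $j=1,\dots,\nu$. (b) The total arrow grading on $K[C]$ is non-negative. (c) The order ideal $\mathcal{O}$ has a generic Hilbert function, i.e., there exists a degree $d\ge0$ such that $\#\mathcal{O}_i=\mathrm{HF}_P(i)$ for $i<d$, such that $\#\mathcal{O}_d>0$, and such that $\#\mathcal{O}_i=0$ for $i>d$.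
   Context: $K$ is a field, $P=K[x_1,\dots,x_n]$, and $\mathbb{T}^n$ is the set of terms (power products) in $x_1,\dots,x_n$. An order ideal is a finite set $\mathcal{O}=\{t_1,\dots,t_\mu\}\subseteq\mathbb{T}^n$ ($\mu\ge1$) closed under taking divisors; its border is $\partial\mathcal{O}=(x_1\mathcal{O}\cup\dots\cup x_n\mathcal{O})\setminus\mathcal{O}$. $\mathcal{O}_i$ is the set of terms of degree $i$ in $\mathcal{O}$, and $\mathrm{HF}_P(i)=\dim_KP_i$. The total arrow grading is the $\mathbb{Z}$-grading on $K[C]$ given by $\deg_W(c_{ij})=\deg(b_j)-\deg(t_i)$; it is non-negative if $\deg_W(c_{ij})\ge0$ for all $i,j$. *)

(* Defs.v *)
From HB Require Import structures.
From mathcomp Require Import all_boot all_order all_algebra.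
From mathcomp Require Export finmap.
From mathcomp Require Export mpoly.

Set Implicit Arguments.
Unset Strict Implicit.
Unset Printing Implicit Defensive.

Import GRing.Theory Num.Theory.
Local Open Scope ring_scope.

(* Terms in n indeterminates are the exponent vectors 'X_{1..n}, written
   additively: (s <= t)%MM is divisibility of terms, (U_(k) + t)%MM is x_k t. *)
Section OrderIdeals.
Variable n : nat.
Implicit Types (O : {fset 'X_{1..n}}) (s t : 'X_{1..n}).

Definition order_ideal O : Prop :=
  O != fset0 /\ forall s t, t \in O -> (s <= t)%MM -> s \in O.

Definition border O : {fset 'X_{1..n}} :=
  ([fset (U_(k) + t)%MM | k in 'I_n, t in O] `\` O)%fset.

Definition terms_of_degree O (d : nat) : {fset 'X_{1..n}} :=
  [fset t in O | mdeg t == d]%fset.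

End OrderIdeals.

(* HF_P(d) = dim_K P_d for P = K[x_0, ..., x_n]. The library makes the space
   dhomog of forms of degree d a vectType only for at least one indeterminate. *)
Definition hilbert_function (K : fieldType) (n d : nat) : nat :=
  \dim {: dhomog n.+1 K d}.

Definition generic_hilbert_function (K : fieldType) (n : nat)
    (O : {fset 'X_{1..n.+1}}) : Prop :=
  exists d : nat,
    [/\ forall i : nat, (i < d)%N ->
          #|` terms_of_degree O i| = hilbert_function K n i,
        (0 < #|` terms_of_degree O d|)%N
      & forall i : nat, (d < i)%N -> #|` terms_of_degree O i| = 0%N].

Definition maxdeg_border (n mu nu : nat)
    (t : mu.-tuple 'X_{1..n}) (b : nu.-tuple 'X_{1..n}) : Prop :=
  forall (i : 'I_mu) (j : 'I_nu), (mdeg (tnth t i) <= mdeg (tnth b j))%N.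

(* K[C] = K[c_11, ..., c_mu,nu] is {mpoly K[mu * nu]}, whose indeterminates are
   indexed by pairs through the bijection mxvec_index. *)
Section WeightGrading.
Variables (K : fieldType) (mu nu : nat).

Definition cvar (i : 'I_mu) (j : 'I_nu) : {mpoly K[mu * nu]} :=
  'X_(mxvec_index i j).

Variable W : 'M[int]_(mu, nu).

Definition wdeg (m : 'X_{1..mu * nu}) : int :=
  \sum_(i < mu) \sum_(j < nu) W i j *+ m (mxvec_index i j).

(* The homogeneous component of degree d of the Z-grading of K[C] in which c_ij
   has degree W i j. The library's homogeneity predicate only allows
   nat-valued degrees. *)
Definition whomog (d : int) : {pred {mpoly K[mu * nu]}} :=
  [pred f : {mpoly K[mu * nu]} | all (fun m => wdeg m == d) (msupp f)].

Lemma cvar_whomog i j d : (cvar i j \in whomog d) = (W i j == d).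
Proof.
rewrite inE /cvar msuppX /= andbT; congr (_ == d).
have eqU i' j' :
  (U_(mxvec_index i j)%MM : 'X_{1..mu * nu}) (mxvec_index i' j')
    = ((i' == i) && (j' == j)) :> nat.
  by rewrite mnm1E (inj_eq (@cast_ord_inj _ _ _)) (inj_eq enum_rank_inj)
             xpair_eqE [i == _]eq_sym [j == _]eq_sym.
rewrite /wdeg (bigD1 i) //= (bigD1 j) //= eqU !eqxx mulr1n.
rewrite big1 => [|j' /negbTE ne]; last by rewrite eqU ne andbF.
rewrite big1 ?addr0 // => i' /negbTE ne.
by rewrite big1 // => j' _; rewrite eqU ne.
Qed.

(* By cvar_whomog, each c_ij is homogeneous of exactly one degree, W i j. *)
Definition nonneg_grading : Prop :=
  forall i j (d : int), cvar i j \in whomog d -> 0 <= d.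

End WeightGrading.

Definition arrow_degree (n mu nu : nat)
    (t : mu.-tuple 'X_{1..n}) (b : nu.-tuple 'X_{1..n}) : 'M[int]_(mu, nu) :=
  \matrix_(i, j) ((mdeg (tnth b j))%:Z - (mdeg (tnth t i))%:Z).

(* Main.v *)
Require Import Defs.
From mathcomp Require Import all_boot all_order all_algebra finmap mpoly.

(** A nonempty set of terms closed under divisors contains the term 1, so
    multiplying up from 1 to a term [s] outside [O] must leave [O] somewhere, and
    the first term reached outside is a border term dividing [s]
    ([border_below]). Hence [s] has degree at least that of some border term, and
    the least degree of a border term is the least degree of a term outside [O]:
    below that degree [O] is everything.

    The border is therefore concentrated in degrees at least [d = max deg t_i]
    exactly when [O] contains all terms of degree less than [d]. As the terms of
    degree [i] form a basis of the forms of degree [i], fullness in degree [i] is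
    the numerical condition of equality with the Hilbert function of the
    polynomial ring ([full_degreeP]), which gives (a) <-> (c). The equivalence
    (a) <-> (b) holds indeterminate by indeterminate, because [c_ij] has the
    single degree [deg b_j - deg t_i]. *)

Set Implicit Arguments.
Unset Strict Implicit.
Unset Printing Implicit Defensive.

Lemma arrow_grading_nonneg (K : fieldType) (n mu nu : nat)
    (t : mu.-tuple 'X_{1..n}) (b : nu.-tuple 'X_{1..n}) :
  maxdeg_border t b <-> nonneg_grading K (arrow_degree t b).
Proof.
split=> [max_b i j d | nonneg i j].
  rewrite cvar_whomog mxE => /eqP <-.
  by rewrite Num.Theory.subr_ge0 lez_nat max_b.
have := nonneg i j (arrow_degree t b i j).
by rewrite cvar_whomog eqxx mxE Num.Theory.subr_ge0 lez_nat; apply.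
Qed.

Section OrderIdealTheory.
Variable n : nat.
Implicit Types (O : {fset 'X_{1..n}}) (s t b : 'X_{1..n}).

Lemma mem_terms_of_degree O d s :
  (s \in terms_of_degree O d) = (s \in O) && (mdeg s == d).
Proof. by rewrite !inE. Qed.

Lemma borderP O b :
  reflect (b \notin O /\ exists k t, t \in O /\ b = (U_(k) + t)%MM)
          (b \in border O).
Proof.
rewrite in_fsetD; apply: (iffP andP) => -[bO].
  by case/imfset2P=> k _ [t tO def_b]; split=> //; exists k, t.
by case=> k [t [tO def_b]]; split=> //; apply/imfset2P; exists k => //; exists t.
Qed.

Lemma order_ideal0 O : order_ideal O -> 0%MM \in O.
Proof.
by case=> /fset0Pn[t tO] /(_ _ t tO); apply; apply/mnm_lepP=> i; rewrite mnmE.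
Qed.

(** Dividing [s] by one indeterminate at a time eventually enters [O], since
    the process ends at 1; the last term before entering is the border term. *)
Lemma border_below O s :
  order_ideal O -> s \notin O -> exists2 b, b \in border O & (b <= s)%MM.
Proof.
move=> idO; elim: {s}(mdeg s) {-2}s (erefl (mdeg s)) => [|d IHd] s deg_s sO.
  by move/eqP: deg_s sO; rewrite mdeg_eq0 => /eqP ->; rewrite order_ideal0.
have [k sk | s0] := pickP (fun k => s k != 0); last first.
  suff s_eq0 : s = 0%MM by move: deg_s; rewrite s_eq0 mdeg0.
  by apply/mnmP=> i; have /negbFE/eqP := s0 i; rewrite mnmE.
have ks : (U_(k) <= s)%MM by rewrite lep1mP.
have def_s : s = (U_(k) + (s - U_(k)))%MM by rewrite addmC submK.
have [s'O | s'O] := boolP ((s - U_(k))%MM \in O).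
  exists s; last exact: lepm_refl.
  by apply/borderP; split=> //; exists k, (s - U_(k))%MM.
have [|b bO le_bs] := IHd (s - U_(k))%MM _ s'O.
  by move: deg_s; rewrite {1}def_s mdegD mdeg1 => -[].
by exists b => //; apply: lepm_trans le_bs (lem_subr _ _).
Qed.

Lemma lepm_mdeg s t : (s <= t)%MM -> mdeg s <= mdeg t.
Proof. by move/submK <-; rewrite mdegD leq_addl. Qed.

Lemma border_max_full O e :
    order_ideal O -> (forall b, b \in border O -> e <= mdeg b) ->
  forall s, mdeg s < e -> s \in O.
Proof.
move=> idO min_b s; apply: contraTT => sO; rewrite -leqNgt.
have [b bO /lepm_mdeg] := border_below idO sO.
exact: leq_trans (min_b b bO).
Qed.

End OrderIdealTheory.

Section GenericHilbertFunction.
Variables (K : fieldType) (n : nat).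
Implicit Types (O : {fset 'X_{1..n.+1}}) (s t b : 'X_{1..n.+1}).

Definition term_seq (d : nat) : seq 'X_{1..n.+1} :=
  [seq s2m t | t : d.-tuple 'I_n.+1 <- enum (basis n.+1 d)].

Lemma hilbert_functionE d : hilbert_function K n d = size (term_seq d).
Proof. by rewrite size_basis /hilbert_function dimvf. Qed.

(** The terms of degree [d] in [O] are among the terms of degree [d], so
    equality of the two counts forces equality of the two sets. *)
Lemma full_degreeP O d :
  #|` terms_of_degree O d| = hilbert_function K n d
  <-> forall s, mdeg s = d -> s \in O.
Proof.
have sub : {subset terms_of_degree O d <= term_seq d}.
  by move=> s; rewrite mem_terms_of_degree -basis_cover => /andP[].
rewrite hilbert_functionE; split=> [eq_card s deg_s | fullO].
  have [_ eq_mem] := uniq_min_size (fset_uniq _) sub (eq_leq (esym eq_card)).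
  have: s \in term_seq d by rewrite -basis_cover deg_s.
  by rewrite -eq_mem mem_terms_of_degree => /andP[].
apply/eqP; rewrite eqn_leq !uniq_leq_size ?uniq_basis ?fset_uniq // => s.
rewrite -basis_cover mem_terms_of_degree => s_d.
by rewrite s_d fullO //; apply/eqP.
Qed.

Lemma generic_hilbert_functionP O :
  generic_hilbert_function K O <->
  exists d, [/\ forall s, mdeg s < d -> s \in O,
                exists2 t, t \in O & mdeg t = d
              & forall t, t \in O -> mdeg t <= d].
Proof.
split=> -[d [full top max_d]]; exists d; split.
- by move=> s lt_sd; apply: (proj1 (full_degreeP O (mdeg s))) => //; apply: full.
- have [t] := fset0Pn _ (introT idP (etrans (esym (cardfs_gt0 _)) top)).
  by rewrite mem_terms_of_degree => /andP[tO /eqP]; exists t.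
- move=> t tO; rewrite leqNgt; apply/negP=> /max_d/cardfs0_eq/fsetP/(_ t).
  by rewrite mem_terms_of_degree tO eqxx inE.
- by move=> i lt_id; apply/full_degreeP => s deg_s; apply: full; rewrite deg_s.
- have [t tO deg_t] := top; rewrite cardfs_gt0; apply/fset0Pn; exists t.
  by rewrite mem_terms_of_degree tO deg_t eqxx.
- move=> i lt_di; apply/eqP; rewrite cardfs_eq0; apply/eqP/fsetP=> t.
  rewrite mem_terms_of_degree inE; apply/negP=> /andP[/max_d le_td /eqP deg_t].
  by move: le_td; rewrite deg_t leqNgt lt_di.
Qed.

Lemma max_degree_term O :
  order_ideal O -> exists2 t, t \in O & forall s, s \in O -> mdeg s <= mdeg t.
Proof.
move/order_ideal0=> O0.
have [t _ max_t] := @arg_maxnP O [` O0]%fset xpredT (fun u => mdeg (val u)) isT.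
by exists (val t); [apply: valP | move=> s sO; apply: (max_t [` sO]%fset)].
Qed.

Lemma generic_hilbert_function_border O :
    order_ideal O ->
  (forall t b, t \in O -> b \in border O -> mdeg t <= mdeg b)
  <-> generic_hilbert_function K O.
Proof.
move=> idO; split=> [max_b | /generic_hilbert_functionP[d [full _ max_d]] t b].
  have [t tO max_t] := max_degree_term idO.
  apply/generic_hilbert_functionP; exists (mdeg t); split=> //; last by exists t.
  by apply: border_max_full => // b; apply: max_b.
move=> /max_d le_td /borderP[bO _]; apply: leq_trans le_td _.
by rewrite leqNgt; apply: contra bO; apply: full.
Qed.

End GenericHilbertFunction.

Theorem proposition3p3 (K : fieldType) (n : nat)
    (O : {fset 'X_{1..n.+1}}) (hO : order_ideal O)
    (mu nu : nat) (t : mu.-tuple 'X_{1..n.+1}) (b : nu.-tuple 'X_{1..n.+1})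
    (t_uniq : uniq t) (t_enum : t =i O)
    (b_uniq : uniq b) (b_enum : b =i border O) :
  [<-> maxdeg_border t b;
       nonneg_grading K (arrow_degree t b);
       generic_hilbert_function K O].
Proof.
tfae.
- by move/(arrow_grading_nonneg K).
- move/arrow_grading_nonneg=> max_b; apply/generic_hilbert_function_border => //.
  move=> s c; rewrite -t_enum -b_enum => /tnthP[i ->] /tnthP[j ->].
  exact: max_b.
- move/(generic_hilbert_function_border K hO) => max_b i j; apply: max_b.
    by rewrite -t_enum mem_tnth.
  by rewrite -b_enum mem_tnth.
Qed.
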